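(* Let $L,\alpha>0$ and let $f:E\to\mathbb{R}$ be an $L$-smooth and $\alpha$-strongly convex function, with unique minimizer $x^*$. Let $x_0\in E$ and let $(x_n)_{n\in\mathbb{N}}$ be the sequence generated by gradient descent with stepsize $\frac1L$, i.e. $x_{n+1}=x_n-\frac{1}{L}\nabla f(x_n)$. Then for all $n\in\mathbb{N}$, $$f(x_n)-f(x^* )\le\left(1-\frac{\alpha}{L}\right)^n\bigl(f(x_0)-f(x^* )\bigr).$$
   Context: $E$ is a finite-dimensional Euclidean space with inner product $\langle\cdot,\cdot\rangle$ and associated norm $\|\cdot\|$. A function $f$ is $L$-smooth if it is differentiable and $\|\nabla f(x)-\nabla f(y)\|\le L\|x-y\|$ for all $x,y\in E$. It is $\alpha$-strongly convex if $x\mapsto f(x)-\frac{\alpha}{2}\|x\|^2$ is convex. *)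

(* Defs.v *)
From HB Require Import structures.
From mathcomp Require Import all_boot all_order all_algebra.
From mathcomp Require Import sesquilinear.
From mathcomp Require Import all_classical all_reals all_analysis.

Set Implicit Arguments.
Unset Strict Implicit.
Unset Printing Implicit Defensive.

Import Order.TTheory GRing.Theory Num.Theory.
Import numFieldNormedType.Exports.

Local Open Scope classical_set_scope.
Local Open Scope ring_scope.

HB.mixin Record NormedVector_isEuclidean (R : realType) (E : Type)
    of NormedModule R E & Vector R E := {
  inner : {dot E for (@idfun R)} ;
  norm_inner : forall x : E, `|x| ^+ 2 = inner x x
}.

(* Finite-dimensional real inner product spaces.  The norm, and hence the
   topology, is the one induced by the inner product; in particular the type
   'rV[R]_n is not an instance with its library (supremum) norm. *)
#[short(type="euclideanType")]
HB.structure Definition Euclidean (R : realType) :=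
  {E of NormedVector_isEuclidean R E & NormedModule R E & Vector R E}.

Section Smooth.
Context {R : realType} {E : euclideanType R}.
Implicit Types (f : E -> R) (x y : E) (L alpha : R).

(* Riesz representative of the differential; it exists and is unique because
   E is finite-dimensional.  Only meaningful where f is differentiable. *)
Definition gradient f x : E :=
  xget 0 [set g : E | forall h : E, 'd f x h = inner g h].

Definition smooth L f : Prop :=
  (forall x, differentiable f x) /\
  (forall x y, `|gradient f x - gradient f y| <= L * `|x - y|).

Definition strongly_convex alpha f : Prop :=
  convex_function [set: convex_lmodType E]
    (fun x : E => f x - alpha / 2 * `|x| ^+ 2).

Definition minimizer f x : Prop := forall y, f x <= f y.

End Smooth.

(* Main.v *)
(* Smoothness along the segment from x to its gradient step, and strong
   convexity compared with the minimizer, give respectively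
     f(x+) <= f(x) - |grad f(x)|^2 / (2L),
     alpha (f(x) - f( x* )) <= |grad f(x)|^2 / 2,
   so each step contracts the gap f - f( x* ) by 1 - alpha/L.  When this factor
   is negative, which only happens if E is trivial, nonnegativity of the gap
   forces it to vanish identically. *)

Require Import Defs.
From HB Require Import structures.
From mathcomp Require Import all_boot all_order all_algebra.
From mathcomp Require Import sesquilinear ring lra.
From mathcomp Require Import all_classical all_reals all_analysis.
Import Order.TTheory GRing.Theory Num.Theory.
Import numFieldNormedType.Exports.
Local Open Scope ring_scope.

Section GradientDescent.
Context {R : realType} {E : euclideanType R}.
Implicit Types (u v w x y : E) (f : E -> R).

Lemma innerC u v : inner u v = inner v u.
Proof. by rewrite hermC expr0 mul1r. Qed.

Lemma innerDl u v w : inner (u + v) w = inner u w + inner v w.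
Proof. exact: linearDl. Qed.

Lemma innerZl a u v : inner (a *: u) v = a * inner u v.
Proof. exact: linearZl_LR. Qed.

Lemma innerDr u v w : inner u (v + w) = inner u v + inner u w.
Proof. by rewrite innerC innerDl !(innerC _ u). Qed.

Lemma innerZr a u v : inner u (a *: v) = a * inner u v.
Proof. by rewrite innerC innerZl innerC. Qed.

Lemma innerNl u v : inner (- u) v = - inner u v.
Proof. by rewrite -scaleN1r innerZl mulN1r. Qed.

Lemma inner0l u : inner 0 u = 0.
Proof. by rewrite -(scale0r u) innerZl mul0r. Qed.

Lemma inner_sumr (I : finType) u (F : I -> E) :
  inner u (\sum_i F i) = \sum_i inner u (F i).
Proof.
apply: (big_morph _ (innerDr u)).
by rewrite innerC inner0l.
Qed.

Lemma sqr_normD u v : `|u + v| ^+ 2 = `|u| ^+ 2 + 2 * inner u v + `|v| ^+ 2.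
Proof. by rewrite !norm_inner innerDl !innerDr (innerC v u); ring. Qed.

(** Cauchy-Schwarz: the square of the norm of [|v| u - |u| v] is nonnegative and expands to
    [2 |u| |v| (|u| |v| - inner u v)]. *)
Lemma inner_le_norm u v : inner u v <= `|u| * `|v|.
Proof.
have [->|u0] := eqVneq u 0; first by rewrite inner0l normr0 mul0r.
have [->|v0] := eqVneq v 0; first by rewrite innerC inner0l normr0 mulr0.
have p : 0 < `|u| * `|v| by rewrite mulr_gt0// normr_gt0.
have := sqr_ge0 `| `|v| *: u + (- `|u|) *: v|.
rewrite sqr_normD innerZl innerZr !normrZ normrN !normr_id => h.
have -> : (inner u v <= `|u| * `|v|)
    = (0 <= 2 * (`|u| * `|v|) * (`|u| * `|v| - inner u v)).
  by rewrite pmulr_rge0 ?subr_ge0// mulr_gt0.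
by move: h; congr (_ <= _); ring.
Qed.

(* Expands the values of the functional <v, .> on a basis: Riesz representation
   reduces to surjectivity, hence to injectivity, of this endomorphism. *)
Definition inner_coord (v : E) : E :=
  \sum_(i < \dim {:E}) inner v (vbasis {:E})`_i *: (vbasis {:E})`_i.

Fact inner_coord_is_linear : linear inner_coord.
Proof.
move=> a u v; rewrite /inner_coord scaler_sumr -big_split/=.
by apply: eq_bigr => i _; rewrite innerDl innerZl scalerDl scalerA.
Qed.

HB.instance Definition _ :=
  GRing.isLinear.Build R E E *:%R inner_coord inner_coord_is_linear.

Lemma inner_eq0 u : (inner u u == 0) = (u == 0).
Proof. by rewrite -norm_inner sqrf_eq0 normr_eq0. Qed.

Lemma sum_vbasis_inj (c d : 'I_(\dim {:E}) -> R) :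
  \sum_i c i *: (vbasis {:E})`_i = \sum_i d i *: (vbasis {:E})`_i -> c =1 d.
Proof.
move=> cd i; have fX := basis_free (vbasisP {:E}).
by rewrite -(coord_sum_free c i fX) cd coord_sum_free.
Qed.

(** If the images agree, [u - v] is orthogonal to every basis vector, hence to itself. *)
Lemma inner_coord_inj : injective inner_coord.
Proof.
move=> u v uv; apply/eqP; rewrite -subr_eq0 -inner_eq0.
have /sum_vbasis_inj h := uv.
rewrite {2}(coord_vbasis (memvf (u - v))) inner_sumr big1 //= => i _.
by rewrite innerZr innerDl innerNl h subrr mulr0.
Qed.

Lemma riesz_representation (phi : {linear E -> R^o}) :
  exists u, forall v, phi v = inner u v.
Proof.
(* A preimage [u] of [b] under [inner_coord] has the same products with the basis vectors as the
   values of [phi] there. *)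
pose b : E := \sum_(i < \dim {:E}) phi (vbasis {:E})`_i *: (vbasis {:E})`_i.
have k0 : lker (linfun inner_coord) == 0%VS.
  by apply/lker0P => u v; rewrite !lfunE; exact: inner_coord_inj.
have : b \in limg (linfun inner_coord) by rewrite lker0_limgf// memvf.
case/memv_imgP => u _; rewrite lfunE => /sum_vbasis_inj h.
exists u => v; rewrite (coord_vbasis (memvf v)) linear_sum inner_sumr.
by apply: eq_bigr => i _; rewrite linearZ innerZr h.
Qed.

(** ['d f x] is linear by construction, so a representative exists and [xget] never falls back on
    [0]. *)
Lemma gradientP f x v : 'd f x v = inner (gradient f x) v.
Proof.
apply: (@xgetPex E 0 [set g : E | forall h, 'd f x h = inner g h]%classic).
exact: (riesz_representation ('d f x)).
Qed.

Lemma is_derive_line f x v (t : R) : (forall y, differentiable f y) ->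
  is_derive t 1 (fun s => f (x + s *: v)) (inner (gradient f (x + t *: v)) v).
Proof.
move=> df; rewrite -gradientP.
set y := x + t *: v.
have eq : (fun h : R => h^-1 *: (f (x + (h *: (1:R) + t) *: v) - f y))
  = (fun h : R => h^-1 *: (f (h *: v + y) - f y)).
  apply/funext => h; congr (_ *: (f _ - _)).
  by rewrite /y scalerDl [h *: 1]mulr1 addrCA.
have D : derivable f y v by exact: diff_derivable.
apply: DeriveDef.
  by rewrite /derivable eq.
by rewrite -deriveE// /derive eq.
Qed.

(* Taking s = 1 and s = -1 bounds the Taylor remainder from both sides. *)
Lemma smooth_taylor L f (s : R) x v : smooth L f -> `|s| = 1 ->
  s * (f (x + v) - f x) <= s * inner (gradient f x) v + L / 2 * `|v| ^+ 2.
Proof.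
move=> [df lipf] s1.
pose g := gradient f x.
(* The claim amounts to [phi 1 <= phi 0]; by the mean value theorem it suffices that [dphi] is
   nonpositive on the open interval. *)
pose phi (t : R) := s * f (x + t *: v) - s * inner g v * t
  - L / 2 * `|v| ^+ 2 * t ^+ 2.
pose dphi (t : R) := s * inner (gradient f (x + t *: v)) v - s * inner g v
  - L * `|v| ^+ 2 * t.
have dphiP (t : R) : is_derive t 1 phi (dphi t).
  have ? := is_derive_line f x v t df.
  by apply: is_derive_eq; rewrite /dphi /GRing.scale/=; field.
have phi_cont : {within `[0, 1], continuous phi}%classic.
  apply: continuous_subspaceT => t.
  by apply/differentiable_continuous/derivable1_diffP; exact: ex_derive.
have [c] := MVT ltr01 (fun t _ => dphiP t) phi_cont.
rewrite in_itv/= => /andP[c0 _] mvt.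
have : dphi c <= 0.
  have -> : dphi c = inner (s *: (gradient f (x + c *: v) - g)) v
      - L * `|v| ^+ 2 * c.
    by rewrite /dphi innerZl innerDl innerNl mulrBr.
  rewrite subr_le0 (le_trans (inner_le_norm _ _))// normrZ s1 mul1r.
  have := lipf (x + c *: v) x.
  rewrite addrAC subrr add0r normrZ (gtr0_norm c0) -/g => h.
  have -> : L * `|v| ^+ 2 * c = L * (c * `|v|) * `|v| by ring.
  exact: ler_wpM2r.
rewrite -[dphi c]mulr1 -[X in _ * X](subr0 1) -mvt /phi.
rewrite scale1r scale0r addr0; lra.
Qed.

(** At [x + t v], convexity bounds [f] from above and [smooth_taylor] with [s = -1] bounds it from
    below. Dividing by [t] leaves the claim up to an error linear in [t]. *)
Lemma strongly_convex_lower_bound L alpha f x y : 0 < L -> 0 < alpha ->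
  smooth L f -> strongly_convex alpha f ->
  f x + inner (gradient f x) (y - x) + alpha / 2 * `|y - x| ^+ 2 <= f y.
Proof.
move=> L0 a0 smf cvxf; set g := gradient f x; set v := y - x.
have bound (t : R) : 0 < t -> t < 1 ->
    inner g v + alpha / 2 * `|v| ^+ 2 - (f y - f x)
    <= t * ((L + alpha) / 2 * `|v| ^+ 2).
  move=> t0 t1.
  pose p : {i01 R} := Itv01 (ltW t0) (ltW t1).
  have := cvxf p y x (in_setT _) (in_setT _); rewrite !convRE /unstable.onem /=.
  have -> : conv p (y : convex_lmodType E) (x : convex_lmodType E)
      = x + t *: v :> E.
    rewrite /conv/= /unstable.onem /v scalerBl scalerBr scale1r.
    by rewrite addrC addrAC addrA.
  have -> : `|y| ^+ 2 = `|x + v| ^+ 2 by rewrite /v addrC subrK.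
  rewrite (sqr_normD x v) (sqr_normD x (t *: v)) innerZr normrZ (gtr0_norm t0).
  move=> cvx_t.
  have := smooth_taylor L f (- 1) x (t *: v) smf (normrN1 R).
  rewrite innerZr normrZ (gtr0_norm t0) -/g => descent_t.
  rewrite -(ler_pM2l t0); lra.
(* Letting t tend to 0 in [bound]. *)
rewrite leNgt; apply/negP => lt_fy.
set C := (L + alpha) / 2 * `|v| ^+ 2 in bound.
have C0 : 0 <= C by rewrite mulr_ge0 ?sqr_ge0// divr_ge0// addr_ge0 ?ltW.
set d := inner g v + alpha / 2 * `|v| ^+ 2 - (f y - f x) in bound.
have d0 : 0 < d by rewrite /d; lra.
have dC : 0 < d + C by lra.
(* This [t] is below 1 and makes [t * C] smaller than [d], contradicting [bound]; adding [d] to [C]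
   covers the case [C = 0]. *)
have /bound : 0 < d / (2 * (d + C)) by rewrite divr_gt0// mulr_gt0.
rewrite ltr_pdivrMr ?mulr_gt0// => /(_ ltac:(lra)).
rewrite mulrAC ler_pdivlMr ?mulr_gt0// ler_pM2l//; lra.
Qed.

Lemma gradient_step L alpha f x xs : 0 < L -> 0 < alpha ->
  smooth L f -> strongly_convex alpha f ->
  f (x - L^-1 *: gradient f x) - f xs <= (1 - alpha / L) * (f x - f xs).
Proof.
move=> L0 a0 smf cvxf; set g := gradient f x.
have up : f (x - L^-1 *: g) - f x <= - (L^-1 * (`|g| ^+ 2 / 2)).
  have := smooth_taylor L f 1 x (- (L^-1 *: g)) smf (normr1 R).
  rewrite -scaleNr innerZr normrZ normrN (gtr0_norm (_ : 0 < L^-1)) ?invr_gt0//.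
  rewrite -norm_inner -/g => /le_trans; rewrite !mul1r; apply.
  by rewrite le_eqVlt; apply/orP; left; apply/eqP; field; rewrite gt_eqF.
have lo := strongly_convex_lower_bound L alpha f x xs L0 a0 smf cvxf.
(* Polyak-Lojasiewicz inequality: completing the square, the quadratic lower bound on [f xs] is
   smallest at displacement [- g / alpha]. *)
have PL : alpha * (f x - f xs) <= `|g| ^+ 2 / 2.
  have := sqr_ge0 `|g + alpha *: (xs - x)|.
  rewrite sqr_normD innerZr normrZ (gtr0_norm a0) => sq.
  have : alpha * (f x + inner g (xs - x) + alpha / 2 * `|xs - x| ^+ 2)
    <= alpha * f xs by rewrite ler_pM2l.
  lra.
have : L^-1 * (alpha * (f x - f xs)) <= L^-1 * (`|g| ^+ 2 / 2).
  by rewrite ler_pM2l ?invr_gt0.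
lra.
Qed.

End GradientDescent.

Theorem theorem3 (R : realType) (E : euclideanType R) (L alpha : R)
    (f : E -> R) (xstar : E) (x : nat -> E) :
  0 < L -> 0 < alpha ->
  smooth L f -> strongly_convex alpha f ->
  unique (minimizer f) xstar ->
  (forall n : nat, x n.+1 = x n - L^-1 *: gradient f (x n)) ->
  forall n : nat,
    f (x n) - f xstar <= (1 - alpha / L) ^+ n * (f (x 0%N) - f xstar).
Proof.
move=> L0 a0 smf cvxf [xmin _] xS.
have gap0 n : 0 <= f (x n) - f xstar by rewrite subr_ge0.
have gapS n : f (x n.+1) - f xstar <= (1 - alpha / L) * (f (x n) - f xstar).
  by rewrite xS; exact: gradient_step.
(* Multiplying the induction hypothesis by the factor preserves its direction only if the factor is
   nonnegative. *)
have [q0|q0] := lerP 0 (1 - alpha / L).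
  elim=> [|n IHn]; first by rewrite expr0 mul1r.
  by rewrite exprS -mulrA (le_trans (gapS n))// ler_wpM2l.
have gap_eq0 n : f (x n) - f xstar = 0.
  apply/eqP; rewrite eq_le gap0 andbT -(nmulr_rge0 _ q0).
  exact: le_trans (gap0 n.+1) (gapS n).
by move=> n; rewrite !gap_eq0 mulr0.
Qed.
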